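(* Let $k>1$ and let $D$ be an orientation of a complete $k$-partite graph. If $\delta^-(D)\geq 1$ (every vertex of $D$ has at least one in-neighbour), then the condensation $D^*$ of $D$ has a source vertex, and $D$ has a watchman's walk.
   Context: Graphs and digraphs are finite. An orientation of an undirected simple graph $G$ is a digraph obtained by assigning exactly one direction to each edge of $G$. $\delta^-(D)$ is the minimum in-degree of $D$. A source vertex is a vertex with no in-neighbours. The condensation $D^*$ of a digraph $D$ is the digraph obtained by contracting each maximal strongly connected component of $D$ to a single vertex; there is an arc in $D^*$ from $W$ to $U$ (with $W\ne U$) when there are arcs in $D$ between the components $W$ and $U$ and they are all directed from a vertex of $W$ to a vertex of $U$. A vertex dominates itself and its out-neighbours; a set $S\subseteq V(D)$ is dominating if every vertex of $D$ is in $S$ or is an out-neighbour of a vertex in $S$. A walk follows the direction of arcs, and may repeat vertices and arcs; its length is the number of arcs traversed (counted with repetition). A closed walk ends where it starts; a single vertex is a closed walk of length $0$. A closed dominating walk is a closed walk whose vertex set is dominating. A watchman's walk of $D$ is a closed dominating walk of minimum length; $D$ has a watchman's walk if and only if it has some closed dominating walk. *)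

(* Defs.v *)
(* A graph or digraph on the finite vertex type V is a [rel V]. *)
From mathcomp Require Import all_boot.

Set Implicit Arguments.
Unset Strict Implicit.
Unset Printing Implicit Defensive.

Definition simple_graph (V : finType) (G : rel V) : Prop :=
  symmetric G /\ irreflexive G.

(* The k parts are the fibres of c; surjectivity of c says that none of them
   is empty. *)
Definition complete_multipartite (k : nat) (V : finType) (G : rel V) : Prop :=
  exists c : V -> 'I_k,
    (forall i : 'I_k, exists v : V, c v = i) /\
    (forall u v : V, G u v = (c u != c v)).

Lemma complete_multipartite_simple (k : nat) (V : finType) (G : rel V) :
  complete_multipartite k G -> simple_graph G.
Proof.
move=> [c [_ Gc]]; split=> [u v|u]; first by rewrite !Gc eq_sym.
by rewrite Gc eqxx.
Qed.

Definition orientation (V : finType) (G D : rel V) : Prop :=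
  (forall u v : V, D u v -> G u v) /\
  (forall u v : V, G u v -> D u v (+) D v u).

Section Digraph.

Variables (V : finType) (D : rel V).

Definition in_neighbours (v : V) : {set V} := [set u | D u v].

Definition in_degree (v : V) : nat := #|in_neighbours v|.

(* The default value #|V| bounds every in-degree, so it does not affect the
   minimum when V is nonempty. *)
Definition min_in_degree : nat := \big[minn/#|V|]_(v : V) in_degree v.

Definition source (v : V) : Prop := in_neighbours v = set0.

Definition strongly_connected (W : {set V}) : bool :=
  (W != set0) &&
  [forall u in W, forall v in W,
     connect [rel x y | [&& x \in W, y \in W & D x y]] u v].

Definition strong_component : finType :=
  {W : {set V} | maxset strongly_connected W}.

Definition condensation : rel strong_component :=
  fun W U =>
    [&& W != U,
        [exists w in val W, exists u in val U, D w u || D u w]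
      & [forall w in val W, forall u in val U, ~~ D u w]].

Definition dominating (S : {set V}) : Prop :=
  forall v : V, v \in S \/ exists2 u, u \in S & D u v.

(* A walk is given by its first vertex x and the sequence p of the vertices
   that follow, so that its length is [size p]. *)
Definition closed_walk (x : V) (p : seq V) : Prop :=
  path D x p /\ last x p = x.

Definition closed_dominating_walk (x : V) (p : seq V) : Prop :=
  closed_walk x p /\ dominating [set y in x :: p].

Definition watchman_walk (x : V) (p : seq V) : Prop :=
  closed_dominating_walk x p /\
  forall (y : V) (q : seq V), closed_dominating_walk y q -> size p <= size q.

End Digraph.

Arguments condensation {V} D _ _.

(* Main.v *)
(** Take a vertex [x] with as few ancestors as possible. Its ancestors then form
    a strong component [W], which no arc enters, so [W] is a source of the
    condensation. As [x] has an in-neighbour, which lies in [W] and in another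
    part than [x], every vertex outside [W] is adjacent to some vertex of [W],
    hence dominated by it. A closed walk through all of [W] is therefore
    dominating. *)

Require Import Defs.
From mathcomp Require Import all_boot.

Set Implicit Arguments.
Unset Strict Implicit.
Unset Printing Implicit Defensive.

Section Digraph.

Variables (V : finType) (D : rel V).

Definition ancestors (x : V) : {set V} := [set y | connect D y x].

Lemma min_in_degree_le v : min_in_degree D <= in_degree D v.
Proof.
rewrite /min_in_degree; have := mem_index_enum v.
elim: (index_enum V) => //= u s IHs; rewrite inE big_cons.
case/predU1P => [<-|/IHs]; first exact: geq_minl.
exact/leq_trans/geq_minr.
Qed.

(** If [y] reaches [x], its ancestors are among those of [x]; when [x] has the fewest, the two sets
    coincide and [x] is an ancestor of [y]. *)
Lemma exists_minimal_ancestors (v : V) :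
  exists x, forall y, connect D y x -> connect D x y.
Proof.
have [x _ min_x] := @arg_minnP V v xpredT (fun x => #|ancestors x|) isT.
exists x => y yx.
have sub_yx : ancestors y \subset ancestors x.
  by apply/subsetP => z; rewrite !inE => /connect_trans; apply.
have /eqP eq_yx : ancestors y == ancestors x by rewrite eqEcard sub_yx min_x.
have: x \in ancestors y by rewrite eq_yx inE.
by rewrite inE.
Qed.

(** Traced back from its end in [W], a path never leaves [W]. This turns connectivity in [D] into
    the connectivity inside [W] that [strongly_connected] asks for. *)
Lemma connect_within (W : {set V}) :
  (forall u v, D u v -> v \in W -> u \in W) ->
  forall u v, v \in W -> connect D u v ->
  connect [rel x y | [&& x \in W, y \in W & D x y]] u v.
Proof.
move=> closedW u v vW /connectP[p].
(* The induction must also carry [u \in W], to which [closedW] is applied at each arc. *)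
suff: forall u, path D u p -> v = last u p ->
    u \in W /\ connect [rel x y | [&& x \in W, y \in W & D x y]] u v.
  by move=> IH Dp /(IH u Dp)[].
elim: p => [|w p IHp] {}u /=; first by move=> _ <-.
case/andP=> Duw /IHp{}IHp /IHp[wW wv]; have uW := closedW _ _ Duw wW.
by split=> //; apply: connect_trans wv; apply: connect1; rewrite /= uW wW.
Qed.

Lemma strongly_connected_sub (U : {set V}) (w x : V) :
  strongly_connected D U -> w \in U -> connect D w x -> U \subset ancestors x.
Proof.
case/andP=> _ /forall_inP scU wU wx; apply/subsetP => u uU; rewrite inE.
apply: connect_trans wx; move/forall_inP: (scU u uU) => /(_ w wU).
by apply: connect_sub => y z /and3P[_ _ /connect1].
Qed.

Section MinimalAncestors.

Variable x : V.
Hypothesis min_x : forall y, connect D y x -> connect D x y.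

Lemma ancestors_closed u v : D u v -> v \in ancestors x -> u \in ancestors x.
Proof. by rewrite !inE => /connect1; apply: connect_trans. Qed.

Lemma ancestors_maxset : maxset (strongly_connected D) (ancestors x).
Proof.
have xx : x \in ancestors x by rewrite inE.
apply/maxsetP; split=> [|U scU subU].
  apply/andP; split; first by apply/set0Pn; exists x.
  apply/forall_inP => u uW; apply/forall_inP => v vW.
  apply: (connect_within ancestors_closed vW).
  by move: uW vW; rewrite !inE => ux /min_x; apply: connect_trans.
apply/eqP; rewrite eqEsubset subU andbT.
exact: strongly_connected_sub scU (subsetP subU x xx) (connect0 _ _).
Qed.

(** The tail of an entering arc is an ancestor of [x], hence so is its whole component [U];
    maximality of [U] then forces equality. *)
Lemma ancestors_source :
  source (condensation D) (exist _ (ancestors x) ancestors_maxset).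
Proof.
apply/setP => U; rewrite !inE; apply/negP => /and3P[neqUW].
case/exists_inP=> w wU /exists_inP[u uW Dwu].
move=> /forall_inP/(_ w wU)/forall_inP/(_ u uW) nDuw.
move: Dwu; rewrite (negPf nDuw) orbF => Dwu.
have wx : connect D w x by have := ancestors_closed Dwu uW; rewrite inE.
have /maxsetP[scU maxU] := valP U.
have subU := strongly_connected_sub scU wU wx.
case/negP: neqUW; apply/eqP/val_inj; rewrite /= (maxU _ _ subU) //.
by have /maxsetP[] := ancestors_maxset.
Qed.

(** Round trips from [x] to each ancestor and back are concatenated. *)
Lemma closed_walk_through_ancestors :
  exists2 p, closed_walk D x p & {subset ancestors x <= x :: p}.
Proof.
suff [p cwp sub_p]: exists2 p, closed_walk D x p &
    {subset enum (ancestors x) <= x :: p}.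
  by exists p => // y; rewrite -mem_enum => /sub_p.
have: all (mem (ancestors x)) (enum (ancestors x)).
  by apply/allP => y; rewrite mem_enum.
elim: (enum _) => [|y s IHs] /=; first by exists [::].
rewrite inE => /andP[yx /IHs[p [Dp lp] sub_p]].
have /connectP[q Dq lq] := min_x yx; have /connectP[r Dr lr] := yx.
exists (p ++ q ++ r).
  by split; rewrite ?cat_path ?last_cat lp -lq -?lr ?Dp ?Dq.
move=> z; rewrite inE -cat_cons mem_cat => /predU1P[->|/sub_p -> //].
(* The vertex [y] ends [q], unless [q] is empty and [y] is [x] itself. *)
rewrite lq; have := mem_last x q; rewrite inE.
by case/predU1P => [->|yq]; rewrite ?mem_head // mem_cat yq orbT.
Qed.

End MinimalAncestors.

Definition dominatingb (S : {set V}) : bool :=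
  [forall v, (v \in S) || [exists u in S, D u v]].

Lemma dominatingP (S : {set V}) : reflect (dominating D S) (dominatingb S).
Proof.
apply: (iffP forallP) => dom v.
  by case/orP: (dom v) => [|/exists_inP]; [left | right].
by apply/orP; case: (dom v) => [|/exists_inP]; [left | right].
Qed.

Lemma closed_dominating_walkP (x : V) (p : seq V) :
  reflect (closed_dominating_walk D x p)
    [&& path D x p, last x p == x & dominatingb [set y in x :: p]].
Proof.
apply: (iffP and3P) => [[Dp /eqP lp /dominatingP dom] | [[Dp lp] dom]] //.
by split=> //; [apply/eqP | apply/dominatingP].
Qed.

Lemma exists_watchman_walk (x : V) (p : seq V) :
  closed_dominating_walk D x p -> exists y q, watchman_walk D y q.
Proof.
move=> cdw_p.
(* Walks of a fixed length form a finite type, so [P] is boolean and has a least witness. *)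
pose P n := [exists y, exists q : n.-tuple V,
  [&& path D y q, last y q == y & dominatingb [set z in y :: q]]].
have P_size y q : closed_dominating_walk D y q -> P (size q).
  move=> /closed_dominating_walkP cdw; apply/existsP; exists y.
  by apply/existsP; exists (in_tuple q).
have exP : exists n, P n by exists (size p); apply: P_size cdw_p.
case: (ex_minnP exP) => n /existsP[y /existsP[q /closed_dominating_walkP cdw]].
move=> min_n; exists y, q; split=> // z r /P_size/min_n.
by rewrite size_tuple.
Qed.

End Digraph.

Theorem theorem2p5 (k : nat) (V : finType) (G D : rel V) :
  1 < k ->
  complete_multipartite k G ->
  orientation G D ->
  1 <= min_in_degree D ->
  (exists W : strong_component D, source (condensation D) W) /\
  (exists (x : V) (p : seq V), watchman_walk D x p).
Proof.
move=> k_gt1 [c [c_surj GE]] [DG GD] deg_gt0.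
(* The part of index 0 is nonempty, so [D] has a vertex. *)
have [v0 _] := c_surj (Ordinal (ltnW k_gt1)).
have [x min_x] := exists_minimal_ancestors D v0.
split.
  exists (exist _ (ancestors D x) (ancestors_maxset min_x)).
  exact: ancestors_source.
have [p cwp sub_p] := closed_walk_through_ancestors min_x.
apply: (@exists_watchman_walk _ _ x p); split=> // v.
have xW : x \in ancestors D x by rewrite inE.
have [u Dux] : exists u, D u x.
  have /card_gt0P[u] := leq_trans deg_gt0 (min_in_degree_le D x).
  by rewrite inE; exists u.
have uW := ancestors_closed Dux xW.
have [vW|vNW] := boolP (v \in ancestors D x); first by left; rewrite inE sub_p.
right; have [w wW Gwv] : exists2 w, w \in ancestors D x & G w v.
  (* If [v] shares the part of [x], the in-neighbour [u] of [x] lies in another part and is adjacent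
     to [v]. *)
  have [cxv|cxv] := eqVneq (c x) (c v); last by exists x; rewrite ?GE.
  by exists u => //; rewrite GE -cxv -GE DG.
exists w; first by rewrite inE sub_p.
(* The opposite arc would make [v] an ancestor of [x]. *)
have := GD _ _ Gwv; have [//|_ /= Dvw] := boolP (D w v).
by rewrite (ancestors_closed Dvw wW) in vNW.
Qed.
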